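(* Let $f\in Y^*$ and let $u\in X$ be the unique solution of $Bu=f$ in $Y^*$. Let $X_H\subset X_{\overline{H}}\subset X$ and $Y_h\subset Y$ be finite-dimensional subspaces, and assume that there is a constant $\overline{c}_S>0$ such that \[ \overline{c}_S \, \| v_{\overline{H}} \|_X \leq \sup_{0 \neq q_h \in Y_h} \frac{\langle B v_{\overline{H}} , q_h \rangle_H}{\| q_h \|_Y} \qquad \text{for all } v_{\overline{H}} \in X_{\overline{H}} . \] Let $(\widetilde{u}_H,p_h) \in X_H \times Y_h$ be the unique solution of \[ \langle A p_h , q_h \rangle_H + \langle B \widetilde{u}_H , q_h \rangle_H = \langle f , q_h \rangle_H, \qquad \langle p_h , B v_H \rangle_H = 0 \qquad \text{for all } (v_H,q_h) \in X_H \times Y_h , \] and let $(\widetilde{u}_{\overline{H}},\overline{p}_h) \in X_{\overline{H}} \times Y_h$ be the unique solution of \[ \langle A \overline{p}_h , q_h \rangle_H + \langle B \widetilde{u}_{\overline{H}} , q_h \rangle_H = \langle f , q_h \rangle_H, \qquad \langle \overline{p}_h , B v_{\overline{H}} \rangle_H = 0 \qquad \text{for all } (v_{\overline{H}},q_h) \in X_{\overline{H}} \times Y_h . \] Assume the saturation assumption \[ \| u - \widetilde{u}_{\overline{H}} \|_X \leq \eta \, \| u - \widetilde{u}_H \|_X \qquad \text{for some } \eta \in (0,1). \] Then the error estimator $\| p_h \|_Y$ is reliable, satisfying \[ \| u - \widetilde{u}_H \|_X \leq \frac{1}{1-\eta} \, \frac{c_2^B}{\overline{c}_S^2} \, \|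 p_h \|_Y . \]
   Context: All spaces are real. $X \subset H \subset X^*$ and $Y \subset H \subset Y^*$ are Gelfand triples of Hilbert spaces, where $X^*, Y^*$ are the duals of $X, Y$ with respect to $H$; $\langle \cdot,\cdot\rangle_H$ denotes the duality pairing (both for $Y^*\times Y$ and for $X^*\times X$, written in either order). $A : Y \to Y^*$ is a bounded linear operator that is self-adjoint and elliptic in $Y$, and $Y$ is equipped with the norm $\| q \|_Y := \sqrt{\langle A q, q\rangle_H}$; $Y^*$ carries the dual norm $\| f \|_{Y^*} := \sup_{0\neq q\in Y} \langle f,q\rangle_H / \| q \|_Y$. $B : X \to Y^*$ is a bounded linear operator which is surjective and for which there are positive constants $c_1^B, c_2^B$ such that for all $v\in X$ \[ \| B v \|_{Y^*} \leq c_2^B \| v \|_X, \qquad \sup_{0\neq q \in Y} \frac{\langle Bv,q\rangle_H}{\| q\|_Y} \geq c_1^B \| v\|_X ; \] thus $B$ is an isomorphism. *)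

(* Defs.v *)
From HB Require Import structures.
From mathcomp Require Import all_boot all_order all_algebra.
From mathcomp Require Import all_classical all_reals all_analysis.

Set Implicit Arguments.
Unset Strict Implicit.
Unset Printing Implicit Defensive.

Import Order.TTheory GRing.Theory Num.Theory.
Import numFieldNormedType.Exports.

Local Open Scope classical_set_scope.
Local Open Scope ring_scope.

(* {dot V for idfun} is MathComp's type of symmetric positive definite bilinear
   forms on V. *)
Record hilbertSpace (R : realType) := HilbertSpace {
  hilbert_sort :> completeNormedModType R;
  hdot : {dot hilbert_sort for idfun};
  hdotE : forall x : hilbert_sort, `|x| = Num.sqrt (hdot x x)
}.

Section Dual.
Context {R : realType} (V : normedModType R).

Definition dual_pred : {pred V -> R^o} :=
  [pred f : V -> R^o | `[< scalar f /\ continuous f >]].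

Record dual := Dual {
  dual_fun :> V -> R^o;
  dual_funP : dual_fun \in dual_pred
}.

HB.instance Definition _ := [isSub for dual_fun].
HB.instance Definition _ := [Choice of dual by <:].

Lemma dual_predP (g : V -> R^o) :
  reflect (scalar g /\ continuous g) (g \in dual_pred).
Proof. exact: asboolP. Qed.

Lemma dual_pred_submod_closed : GRing.submod_closed dual_pred.
Proof.
split.
  apply/dual_predP; split=> [a u v|x]; last exact: cst_continuous.
  by rewrite /= mulr0 addr0.
move=> a f g /dual_predP[lf cf] /dual_predP[lg cg].
apply/dual_predP; split=> [b u v|x].
  rewrite !fctE lf lg scalerDr mulrDr -!addrA; congr (_ + _).
    by rewrite -![_ *: _]/(_ * _) mulrCA.
  by rewrite addrCA.
apply: continuousD; last exact: cg.
by apply: continuousZl_tmp; exact: cf.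
Qed.

HB.instance Definition _ :=
  GRing.isSubmodClosed.Build R (V -> R^o) dual_pred dual_pred_submod_closed.
HB.instance Definition _ := [SubChoice_isSubLmodule of dual by <:].

End Dual.

(* X \subset H \subset X^*, the inclusions being linear maps.  The pairing
   <f, v>_H of f in X^* with v in X is the evaluation f v; by gelfand_pairingE
   it extends the inner product of H. *)
Record gelfandTriple (R : realType) (X H : hilbertSpace R) := GelfandTriple {
  gelfand_incl : {linear X -> H};
  gelfand_incl_inj : injective gelfand_incl;
  gelfand_incl_continuous : continuous gelfand_incl;
  gelfand_incl_dense : dense (range gelfand_incl);
  gelfand_dual_incl : {linear H -> dual X};
  gelfand_pairingE : forall h x,
    gelfand_dual_incl h x = hdot H h (gelfand_incl x)
}.

Section Statement.
Context {R : realType}.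

(* sup_(0 != q in S) f q / N q.  If S = {0}, this is [sup set0] = 0, the value
   required by the inf-sup condition on the trivial subspace. *)
Definition sup_quotient (V : normedModType R) (N : V -> R) (S : set V)
    (f : dual V) : R :=
  sup [set f q / N q | q in S `\ 0].

Definition dual_norm (V : normedModType R) (N : V -> R) (f : dual V) : R :=
  sup_quotient N setT f.

Definition bounded_dual_op (V : normedModType R) (A : {linear V -> dual V}) :=
  exists C : R, forall q, dual_norm (fun r => `|r|) (A q) <= C * `|q|.

Definition self_adjoint (V : normedModType R) (A : {linear V -> dual V}) :=
  forall p q, A p q = A q p.

Definition elliptic (V : normedModType R) (A : {linear V -> dual V}) :=
  exists2 c : R, 0 < c & forall q, c * `|q| ^+ 2 <= A q q.

(* This is the norm ||q||_Y.  In contrast, `|q| is the norm of the given Hilbert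
   structure of Y, with respect to which A is bounded and elliptic. *)
Definition energy_norm (V : normedModType R) (A : {linear V -> dual V}) (q : V)
    : R :=
  Num.sqrt (A q q).

Definition findim_subspace (V : normedModType R) (S : set V) :=
  GRing.submod_closed (mem S) /\
  exists n (b : 'I_n -> V), forall v, S v ->
    exists c : 'I_n -> R, v = \sum_(i < n) c i *: b i.

Definition mixed_solution (X Y : normedModType R) (A : {linear Y -> dual Y})
    (B : {linear X -> dual Y}) (f : dual Y) (XH : set X) (Yh : set Y)
    (u : X) (p : Y) :=
  [/\ XH u, Yh p,
      forall q, Yh q -> A p q + B u q = f q
    & forall v, XH v -> B v p = 0].

End Statement.

(* Main.v *)
(* Put w := uHbar - uH and e := ph - phbar.  Subtracting the two discrete systems
   gives <A e, q> = <B w, q> for q in Yh, so the inf-sup condition yields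
   cS |w| <= |e|_Y.  As phbar is orthogonal to B XHbar,
   |e|_Y^2 = <B w, e> = <B w, ph> <= c2B |w| |ph|_Y; hence
   |w| <= c2B / cS^2 |ph|_Y, and saturation gives (1 - eta) |u - uH| <= |w|. *)
Require Import Defs.
From HB Require Import structures.
From mathcomp Require Import all_boot all_order all_algebra.
From mathcomp Require Import all_classical all_reals all_analysis.
From mathcomp Require Import ring lra.

Set Implicit Arguments.
Unset Strict Implicit.
Unset Printing Implicit Defensive.

Import Order.TTheory GRing.Theory Num.Theory.
Import numFieldNormedType.Exports.

Local Open Scope classical_set_scope.
Local Open Scope ring_scope.

Section EnergyNorm.
Context {R : realType}.

Lemma dualP (V : normedModType R) (f : dual V) (a : R) (x y : V) :
  f (a *: x + y) = a * f x + f y.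
Proof. by have /dual_predP[lf _] := dual_funP f; exact: lf. Qed.

Lemma dual0 (V : normedModType R) (f : dual V) : f 0 = 0.
Proof. by have := dualP f (-1) 0 0; rewrite scaler0 addr0 mulN1r addNr. Qed.

Lemma dualZ (V : normedModType R) (f : dual V) (a : R) (x : V) :
  f (a *: x) = a * f x.
Proof. by rewrite -[a *: x]addr0 dualP dual0 addr0. Qed.

(** Continuity at 0 together with linearity gives a global bound; it later shows that the quotients
    defining [dual_norm] are bounded above. *)
Lemma dual_bounded (V : normedModType R) (f : dual V) :
  exists2 M : R, 0 < M & forall x, `|f x| <= M * `|x|.
Proof.
have /dual_predP[lf cf] := dual_funP f.
pose g : V -> R^o := f.
pose gL := GRing.isLinear.Build R V R^o *:%R g lf.
pose G : {linear V -> R^o} := HB.pack g gL.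
have /linear_boundedP : bounded_near G (nbhs (0 : V)).
  by apply: continuous_linear_bounded; exact: cf.
move=> [M [Mr HM]].
(* [HM] holds for every constant strictly above [M]; this choice is such a constant and is also
   positive. *)
exists (`|M| + 1) => [|x]; first by rewrite ltr_wpDl.
by apply: HM; rewrite (le_lt_trans (ler_norm _))// ltrDl.
Qed.

Lemma op_linl (V W : normedModType R) (A : {linear V -> dual W}) a x y z :
  A (a *: x + y) z = a * A x z + A y z.
Proof. by rewrite linearP. Qed.

Lemma op_scalel (V W : normedModType R) (A : {linear V -> dual W}) a x z :
  A (a *: x) z = a * A x z.
Proof. by rewrite linearZ. Qed.

Lemma op_subl (V W : normedModType R) (A : {linear V -> dual W}) x y z :
  A (x - y) z = A x z - A y z.
Proof. by rewrite linearB. Qed.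

(** [0 <= M] covers the case where [S] has no nonzero element: the supremum is then taken over the
    empty set and equals 0. *)
Lemma sup_quotient_le (V : normedModType R) (N : V -> R) (S : set V)
    (f : dual V) (M : R) :
  0 <= M -> (forall q, S q -> q != 0 -> f q / N q <= M) ->
  sup_quotient N S f <= M.
Proof.
move=> M0 fM; rewrite /sup_quotient; set E := (X in sup X).
have [->|/set0P E0] := eqVneq E set0; first by rewrite sup0.
by apply: ge_sup => // _ [q [Sq /eqP q0] <-]; exact: fM.
Qed.

Section EllipticOperator.
Context {V : normedModType R} (A : {linear V -> dual V}).
Hypothesis A_elliptic : elliptic A.

Lemma elliptic_ge0 q : 0 <= A q q.
Proof.
have [c c0 cA] := A_elliptic.
by apply: le_trans (cA q); exact: mulr_ge0 (ltW c0) (exprn_ge0 _ (normr_ge0 _)).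
Qed.

Lemma elliptic_gt0 q : q != 0 -> 0 < A q q.
Proof.
have [c c0 cA] := A_elliptic => q0.
by apply: lt_le_trans (cA q); rewrite mulr_gt0// exprn_gt0// normr_gt0.
Qed.

Lemma energy_norm_gt0 q : q != 0 -> 0 < energy_norm A q.
Proof. by move=> q0; rewrite sqrtr_gt0 elliptic_gt0. Qed.

Lemma energy_norm_sqr q : energy_norm A q ^+ 2 = A q q.
Proof. by rewrite sqr_sqrtr ?elliptic_ge0. Qed.

Lemma energy_cauchy_schwarz (A_sym : self_adjoint A) p q :
  A p q <= energy_norm A p * energy_norm A q.
Proof.
have [->|q0] := eqVneq q 0.
  by rewrite dual0 mulr_ge0// sqrtr_ge0.
rewrite -sqrtrM ?elliptic_ge0//; apply: le_trans (ler_norm _) _.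
rewrite -sqrtr_sqr ler_wsqrtr//.
(* The quadratic form at the minimiser of [p - t *: q] over [t], scaled by [A q q] to avoid
   division. It expands to [A q q * (A p p * A q q - A p q ^+ 2)], whose first factor is positive
   since [q != 0]. *)
have := elliptic_ge0 (A q q *: p + - A p q *: q).
rewrite op_linl op_scalel !dualP !dualZ (A_sym q p) => h.
rewrite -subr_ge0 -(pmulr_rge0 _ (elliptic_gt0 q0)).
by apply: le_trans h _; rewrite le_eqVlt; apply/orP; left; apply/eqP; ring.
Qed.

(* The boundedness of the quotients must be proved: on an unbounded set,
   [sup] is 0 and the inequality would fail. *)
Lemma le_dual_energy_norm (f : dual V) q :
  f q <= dual_norm (energy_norm A) f * energy_norm A q.
Proof.
have [->|q0] := eqVneq q 0.
  by rewrite dual0 /energy_norm dual0 sqrtr0 mulr0.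
rewrite -ler_pdivrMr ?energy_norm_gt0//.
have [M M0 fM] := dual_bounded f; have [c c0 cA] := A_elliptic.
apply: ub_le_sup; last by exists q => //; split=> //; exact/eqP.
(* Continuity gives [f r <= M * |r|], and ellipticity gives
   [|r| * Num.sqrt c <= energy_norm A r]. *)
exists (M / Num.sqrt c) => _ [r [_ /eqP r0] <-].
rewrite ler_pdivrMr ?energy_norm_gt0// mulrAC ler_pdivlMr ?sqrtr_gt0//.
have le_r : `|r| * Num.sqrt c <= energy_norm A r.
  rewrite -[`|r|]ger0_norm// -sqrtr_sqr -sqrtrM ?sqr_ge0//.
  by rewrite ler_wsqrtr// mulrC.
apply: le_trans (ler_wpM2l (ltW M0) le_r).
rewrite mulrA ler_wpM2r ?sqrtr_ge0//.
by apply: le_trans (ler_norm _) (fM r).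
Qed.

End EllipticOperator.
End EnergyNorm.

Theorem lemma2p6 (R : realType) (X Y H : hilbertSpace R)
    (triX : gelfandTriple X H) (triY : gelfandTriple Y H)
    (A : {linear Y -> dual Y})
    (A_bounded : bounded_dual_op A)
    (A_self_adjoint : self_adjoint A)
    (A_elliptic : elliptic A)
    (B : {linear X -> dual Y})
    (B_surjective : forall g : dual Y, exists v : X, B v = g)
    (c1B c2B : R) (c1B_gt0 : 0 < c1B) (c2B_gt0 : 0 < c2B)
    (B_bounded : forall v : X, dual_norm (energy_norm A) (B v) <= c2B * `|v|)
    (B_infsup : forall v : X,
      c1B * `|v| <= sup_quotient (energy_norm A) setT (B v))
    (f : dual Y) (u : X) (u_sol : B u = f)
    (XH XHbar : set X) (Yh : set Y)
    (XH_findim : findim_subspace XH)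
    (XHbar_findim : findim_subspace XHbar)
    (Yh_findim : findim_subspace Yh)
    (XH_sub : XH `<=` XHbar)
    (cS : R) (cS_gt0 : 0 < cS)
    (discrete_infsup : forall v : X, XHbar v ->
      cS * `|v| <= sup_quotient (energy_norm A) Yh (B v))
    (uH : X) (ph : Y) (uH_sol : mixed_solution A B f XH Yh uH ph)
    (uHbar : X) (phbar : Y)
    (uHbar_sol : mixed_solution A B f XHbar Yh uHbar phbar)
    (eta : R) (eta_gt0 : 0 < eta) (eta_lt1 : eta < 1)
    (saturation : `|u - uHbar| <= eta * `|u - uH|) :
  `|u - uH| <= 1 / (1 - eta) * (c2B / cS ^+ 2) * energy_norm A ph.
Proof.
have [uHX phY eqH _] := uH_sol.
have [uHbX phbY eqHb orthb] := uHbar_sol.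
have [[_ subX] _] := XHbar_findim.
have [[_ subY] _] := Yh_findim.
have lincomb (V : normedModType R) (S : set V) (x y : V) :
    GRing.linear_closed (mem S) -> S x -> S y -> S (x - y).
  move=> cl Sx Sy; rewrite addrC -scaleN1r.
  by have := cl (-1) y x; rewrite !inE; apply.
pose w := uHbar - uH; pose e := ph - phbar; pose N := energy_norm A.
(* Nestedness of the trial spaces enters here: both the inf-sup condition and the orthogonality of
   [phbar] can be applied to [w]. *)
have wX : XHbar w by apply: lincomb => //; exact: XH_sub.
have eY : Yh e by exact: lincomb.
have eqAB q : Yh q -> A e q = B w q.
  move=> Yq; have := eqH _ Yq; have := eqHb _ Yq.
  rewrite !op_subl; lra.
have infsup : cS * `|w| <= N e.
  apply: le_trans (discrete_infsup _ wX) _.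
  apply: sup_quotient_le => [|q Yq q0]; first exact: sqrtr_ge0.
  rewrite ler_pdivrMr ?energy_norm_gt0// -eqAB//.
  exact: energy_cauchy_schwarz.
have Ne2 : N e ^+ 2 <= c2B * `|w| * N ph.
  rewrite energy_norm_sqr// eqAB//.
  have -> : B w e = B w ph.
    by rewrite /e addrC -scaleN1r dualP orthb// mulr0 add0r.
  (* Duality in the energy norm reduces the pairing to the dual norm of [B w], which [B_bounded]
     controls; this is the source of [c2B]. *)
  apply: le_trans (le_dual_energy_norm A_elliptic _ _) _.
  by rewrite ler_wpM2r ?sqrtr_ge0.
have le_w : `|w| <= c2B / cS ^+ 2 * N ph.
  rewrite mulrAC ler_pdivlMr ?exprn_gt0//.
  (* Combining [infsup] and [Ne2] gives [(cS * |w|) ^+ 2 <= c2B * |w| * N ph]; one factor [|w|] is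
     cancelled, so [|w| = 0] is treated apart. *)
  have [w0|w0] := eqVneq `|w| 0.
    by rewrite w0 mul0r mulr_ge0 ?sqrtr_ge0 ?(ltW c2B_gt0).
  have wp : 0 < `|w| by rewrite lt_def w0 normr_ge0.
  rewrite -(ler_pM2l wp) [leRHS]mulrA [_ * c2B]mulrC.
  apply: le_trans Ne2; rewrite mulrA -expr2 -exprMn mulrC.
  by rewrite lerXn2r ?nnegrE ?sqrtr_ge0// mulr_ge0 ?(ltW cS_gt0).
rewrite mul1r -mulrA mulrC ler_pdivlMr ?subr_gt0//.
apply: le_trans le_w.
have : `|u - uH| <= `|u - uHbar| + `|w|.
  by apply: le_trans (ler_normD _ _); rewrite /w addrA subrK.
by move: saturation; lra.
Qed.
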